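(* The existence of a Dedekind system is equivalent to that of a Dedekind-infinite set; that is, there exists a Dedekind system if and only if there exists a Dedekind-infinite set.
   Context: A counting system is a triple $(X,f,x_0)$ with $X$ a set, $f : X \to X$ a mapping and $x_0 \in X$. A subset $Y \subset X$ is $f$-invariant if $f(Y) \subset Y$. The counting system is minimal if the only $f$-invariant subset of $X$ containing $x_0$ is $X$ itself; it is standard if $f$ is injective and $f(x) \ne x_0$ for all $x \in X$; it is a Dedekind system if it is both minimal and standard. A set $Y$ is Dedekind-infinite if there exists a mapping $g : Y \to Y$ which is injective but not surjective. Existence of an infinite set is not assumed. *)

(* Defs.v *)
(* The inductive type [nat] makes an infinite set available in the ambient type
   theory, so if sets were read as types then both the existence of a Dedekind
   system and that of a Dedekind-infinite set would hold outright.  Here sets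
   are the objects of an arbitrary structure satisfying Zermelo set theory
   without the axiom of infinity (and without choice or foundation), and
   mappings are sets of Kuratowski ordered pairs in that structure.  In
   particular every model of ZF minus infinity is covered, including those
   (such as the hereditarily finite sets) in which every set is finite. *)

Record membership_structure : Type := {
  obj :> Type;
  mem : obj -> obj -> Prop
}.
Arguments mem {_}.

Notation "x ∈ A" := (mem x A) (at level 70, no associativity).

Definition subset {M : membership_structure} (A B : M) : Prop :=
  forall x : M, x ∈ A -> x ∈ B.

Notation "A ⊆ B" := (subset A B) (at level 70, no associativity).

(* First-order formulas of the language of set theory, with named variables. *)
Inductive formula : Type :=
  | FMem (i j : nat)
  | FEq (i j : nat)
  | FFalse
  | FAnd (p q : formula)
  | FOr (p q : formula)
  | FImp (p q : formula)
  | FAll (i : nat) (p : formula)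
  | FEx (i : nat) (p : formula).

Definition update {T : Type} (e : nat -> T) (i : nat) (x : T) : nat -> T :=
  fun j => if Nat.eqb j i then x else e j.

Fixpoint sat {M : membership_structure} (e : nat -> M) (p : formula) : Prop :=
  match p with
  | FMem i j => e i ∈ e j
  | FEq i j => e i = e j
  | FFalse => False
  | FAnd p q => sat e p /\ sat e q
  | FOr p q => sat e p \/ sat e q
  | FImp p q => sat e p -> sat e q
  | FAll i p => forall x : M, sat (update e i x) p
  | FEx i p => exists x : M, sat (update e i x) p
  end.

(* z = {a, b} *)
Definition is_upair {M : membership_structure} (z a b : M) : Prop :=
  forall w : M, w ∈ z <-> w = a \/ w = b.

(* p = (a, b) = {{a}, {a, b}} *)
Definition is_opair {M : membership_structure} (p a b : M) : Prop :=
  exists s d : M, is_upair s a a /\ is_upair d a b /\ is_upair p s d.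

Record Zermelo_without_infinity (M : membership_structure) : Prop := {
  extensionality :
    forall A B : M, (forall x : M, x ∈ A <-> x ∈ B) -> A = B;
  empty_set :
    exists A : M, forall x : M, ~ x ∈ A;
  pairing :
    forall a b : M, exists z : M, is_upair z a b;
  union :
    forall A : M, exists U : M,
      forall x : M, x ∈ U <-> exists B : M, B ∈ A /\ x ∈ B;
  power_set :
    forall A : M, exists P : M, forall B : M, B ∈ P <-> B ⊆ A;
  (* Variable 0 stands for the candidate element, the others for parameters. *)
  separation :
    forall (p : formula) (e : nat -> M) (A : M), exists B : M,
      forall x : M, x ∈ B <-> x ∈ A /\ sat (update e 0 x) p
}.

Definition maps_to {M : membership_structure} (f x y : M) : Prop :=
  exists p : M, p ∈ f /\ is_opair p x y.

(* f : A -> B *)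
Definition is_mapping {M : membership_structure} (f A B : M) : Prop :=
  (forall p : M, p ∈ f -> exists x y : M, x ∈ A /\ y ∈ B /\ is_opair p x y) /\
  (forall x : M, x ∈ A -> exists! y : M, maps_to f x y).

Definition injective {M : membership_structure} (f : M) : Prop :=
  forall x x' y : M, maps_to f x y -> maps_to f x' y -> x = x'.

Definition surjective_onto {M : membership_structure} (f B : M) : Prop :=
  forall y : M, y ∈ B -> exists x : M, maps_to f x y.

Definition counting_system {M : membership_structure} (X f x0 : M) : Prop :=
  is_mapping f X X /\ x0 ∈ X.

(* f(Y) ⊆ Y *)
Definition invariant {M : membership_structure} (f Y : M) : Prop :=
  forall x y : M, x ∈ Y -> maps_to f x y -> y ∈ Y.

Definition minimal {M : membership_structure} (X f x0 : M) : Prop :=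
  forall Y : M, Y ⊆ X -> invariant f Y -> x0 ∈ Y -> Y = X.

Definition standard {M : membership_structure} (X f x0 : M) : Prop :=
  injective f /\ forall x : M, x ∈ X -> ~ maps_to f x x0.

Definition Dedekind_system {M : membership_structure} (X f x0 : M) : Prop :=
  counting_system X f x0 /\ minimal X f x0 /\ standard X f x0.

Definition Dedekind_infinite {M : membership_structure} (Y : M) : Prop :=
  exists g : M, is_mapping g Y Y /\ injective g /\ ~ surjective_onto g Y.

(* Main.v *)
(** From a Dedekind system [(X, f, x0)], [f] itself witnesses that [X] is
    Dedekind-infinite, as it misses [x0].  Conversely, let [g : Y -> Y] be
    injective and miss [y0].  The intersection of all [g]-invariant sets
    containing [y0] is a set by separation, and restricting [g] to it gives a
    Dedekind system with first element [y0]. *)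

Require Import Defs.
From Stdlib Require Import Classical.

(** The singleton [s'] is [s] or [d], and either way [a = a']. Comparing [d] and [d'] with the
    members of [p] then puts each of [b], [b'] equal to [a] or to the other. *)
Lemma opair_inj {M : membership_structure} (p a b a' b' : M) :
  is_opair p a b -> is_opair p a' b' -> a = a' /\ b = b'.
Proof.
  intros (s & d & Hs & Hd & Hp) (s' & d' & Hs' & Hd' & Hp').
  assert (Ea : a = a').
  { assert (Ha : a' ∈ s') by (apply Hs'; now left).
    assert (Hsp : s' ∈ p) by (apply Hp'; now left).
    apply Hp in Hsp as [-> | ->].
    - apply Hs in Ha as [-> | ->]; reflexivity.
    - assert (Had : a ∈ d) by (apply Hd; now left).
      apply Hs' in Had as [-> | ->]; reflexivity. }
  subst a'; split; [reflexivity |].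
  assert (Hb : b ∈ d) by (apply Hd; now right).
  assert (Hb' : b' ∈ d') by (apply Hd'; now right).
  assert (Hdp : d ∈ p) by (apply Hp; now right).
  assert (Hdp' : d' ∈ p) by (apply Hp'; now right).
  assert (E1 : b = a \/ b = b').
  { apply Hp' in Hdp as [-> | ->].
    - apply Hs' in Hb; tauto.
    - now apply Hd' in Hb. }
  assert (E2 : b' = a \/ b' = b).
  { apply Hp in Hdp' as [-> | ->].
    - apply Hs in Hb'; tauto.
    - now apply Hd in Hb'. }
  destruct E1, E2; congruence.
Qed.

Lemma maps_to_in {M : membership_structure} (f A B x y : M) :
  is_mapping f A B -> maps_to f x y -> x ∈ A /\ y ∈ B.
Proof.
  intros [Hf _] (p & Hp & Hxy).
  destruct (Hf p Hp) as (x' & y' & Hx & Hy & Hxy').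
  now destruct (opair_inj _ _ _ _ _ Hxy Hxy') as [-> ->].
Qed.

(** The equivalence is written as two implications, so that [sat] unfolds to [is_upair]. The bound
    variable [w] must differ from [z], [a] and [b]. *)
Definition FUpair (z a b w : nat) : formula :=
  FAll w (FAnd (FImp (FMem w z) (FOr (FEq w a) (FEq w b)))
               (FImp (FOr (FEq w a) (FEq w b)) (FMem w z))).

(* The bound variables 7, 8, 9 must differ from [p], [a] and [b]. *)
Definition FOpair (p a b : nat) : formula :=
  FEx 7 (FEx 8 (FAnd (FUpair 7 a a 9) (FAnd (FUpair 8 a b 9) (FUpair p 7 8 9)))).

Lemma invariant_hull {M : membership_structure}
    (HM : Zermelo_without_infinity M) (Y g y0 : M) :
  exists X : M, forall x : M,
    x ∈ X <-> x ∈ Y /\ forall Z : M, invariant g Z -> y0 ∈ Z -> x ∈ Z.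
Proof.
  (* Variables: 0 is [x], 1 is [g], 2 is [y0] (the default value), 3 is [Z]; 4 and 5 are an argument
     and its image, 6 their pair in [g]. *)
  exact (separation M HM
    (FAll 3 (FImp
      (FAll 4 (FAll 5 (FImp (FMem 4 3)
        (FImp (FEx 6 (FAnd (FMem 6 1) (FOpair 6 4 5))) (FMem 5 3)))))
      (FImp (FMem 2 3) (FMem 0 3))))
    (fun n => match n with 1 => g | _ => y0 end) Y).
Qed.

Lemma restriction {M : membership_structure}
    (HM : Zermelo_without_infinity M) (g X : M) :
  exists f : M,
    (forall p : M, p ∈ f <-> p ∈ g /\ exists x y : M, x ∈ X /\ is_opair p x y) /\
    (forall x y : M, maps_to f x y <-> x ∈ X /\ maps_to g x y).
Proof.
  assert (H : exists f : M, forall p : M,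
    p ∈ f <-> p ∈ g /\ exists x y : M, x ∈ X /\ is_opair p x y).
  (* Variable 0 is the pair [p], 1 is [X], 2 and 3 are the coordinates. *)
  { exact (separation M HM
      (FEx 2 (FEx 3 (FAnd (FMem 2 1) (FOpair 0 2 3)))) (fun _ => X) g). }
  destruct H as [f Hf]; exists f; split; [exact Hf |].
  intros x y; split.
  - intros (p & Hp & Hxy).
    apply Hf in Hp as (Hg & x' & y' & Hx & Hxy').
    destruct (opair_inj _ _ _ _ _ Hxy Hxy') as [-> ->].
    split; [assumption | now exists p].
  - intros (Hx & p & Hp & Hxy).
    exists p; split; [apply Hf; split; [assumption | now exists x, y] | assumption].
Qed.

Lemma Dedekind_system_infinite {M : membership_structure} (X f x0 : M) :
  Dedekind_system X f x0 -> Dedekind_infinite X.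
Proof.
  intros ([Hf Hx0] & _ & Hinj & Hmiss).
  exists f; split; [assumption | split; [assumption |]].
  intros Hsurj; destruct (Hsurj x0 Hx0) as [x Hx].
  now apply (Hmiss x (proj1 (maps_to_in _ _ _ _ _ Hf Hx))).
Qed.

Lemma Dedekind_infinite_system {M : membership_structure}
    (HM : Zermelo_without_infinity M) (Y : M) :
  Dedekind_infinite Y -> exists X f x0 : M, Dedekind_system X f x0.
Proof.
  intros (g & Hg & Hinj & Hns).
  (* Classical logic extracts a missed point [y0] from the failure of surjectivity. *)
  apply not_all_ex_not in Hns as [y0 Hns].
  apply imply_to_and in Hns as [Hy0 Hmiss].
  destruct (invariant_hull HM Y g y0) as [X HX].
  destruct (restriction HM g X) as (f & Hf & Hfg).
  assert (Xinv : invariant g X).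
  { intros x y Hx Hxy; apply HX; split.
    - now apply (maps_to_in _ _ _ _ _ Hg Hxy).
    - intros Z HZ HyZ; apply HX in Hx as [_ Hx].
      exact (HZ x y (Hx Z HZ HyZ) Hxy). }
  exists X, f, y0; repeat split.
  - intros p Hp; apply Hf in Hp as (Hp & x & y & Hx & Hxy).
    exists x, y; split; [assumption | split; [| assumption]].
    apply (Xinv x y Hx); now exists p.
  - intros x Hx.
    destruct (proj2 Hg x (proj1 (proj1 (HX x) Hx))) as (y & Hxy & Huniq).
    exists y; split; [now apply Hfg |].
    intros y' Hy'; apply Huniq; now apply Hfg in Hy'.
  - apply HX; auto.
  (* Minimality: since [Z ⊆ X], the maps [f] and [g] agree on [Z], so [Z] is also [g]-invariant. It
     is thus one of the sets being intersected and contains [X]. *)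
  - intros Z HZX HZ HyZ.
    apply (extensionality M HM); intros x; split; [apply HZX |].
    intros Hx; apply HX in Hx as [_ Hx]; apply Hx; [| assumption].
    intros u v Hu Huv; apply (HZ u v Hu), Hfg; auto.
  - intros x x' y Hx Hx'.
    apply Hfg in Hx as [_ Hx]; apply Hfg in Hx' as [_ Hx'].
    exact (Hinj x x' y Hx Hx').
  - intros x _ Hx; apply Hmiss; exists x; now apply Hfg in Hx.
Qed.

Theorem proposition1p2 (M : membership_structure)
    (HM : Zermelo_without_infinity M) :
  (exists X f x0 : M, Dedekind_system X f x0) <->
  (exists Y : M, Dedekind_infinite Y).
Proof.
  split.
  - intros (X & f & x0 & H); exists X; exact (Dedekind_system_infinite X f x0 H).
  - intros (Y & H); exact (Dedekind_infinite_system HM Y H).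
Qed.
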